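(* The interleaving distance $d_I$ of Reeb graphs ($\mathbb{R}$-graphs) and the induced intrinsic interleaving distance $\hat d_I$ differ globally by at least a factor of $2$; that is, any constant $c\ge0$ such that $\hat d_I(\mathbb{X},\mathbb{Y})\le c\cdot d_I(\mathbb{X},\mathbb{Y})$ for all $\mathbb{R}$-graphs $\mathbb{X},\mathbb{Y}$ satisfies $c\ge2$.
   Context: An $\mathbb{R}$-graph (Reeb graph) in the sense of de Silva, Munch and Patel is a pair $(X,f)$ of a space $X$ and a continuous $f\colon X\to\mathbb{R}$ that arises (up to isomorphism over $\mathbb{R}$) as follows: there are reals $a_0<\dots<a_n$, finite sets $V_0,\dots,V_n$ and $E_0,\dots,E_{n-1}$, and maps $\ell_i\colon E_i\to V_i$, $r_i\colon E_i\to V_{i+1}$; $X$ is the quotient of $\coprod_i V_i\times\{a_i\}\sqcup\coprod_iE_i\times[a_i,a_{i+1}]$ by $(e,a_i)\sim(\ell_i(e),a_i)$ and $(e,a_{i+1})\sim(r_i(e),a_{i+1})$, and $f$ is the projection to the second factor. Morphisms are continuous maps commuting with the functions to $\mathbb{R}$. For $\delta\ge0$ the $\delta$-smoothing $U_\delta(X,f)$ is the Reeb graph of $X\times[-\delta,\delta]\to\mathbb{R}$, $(x,t)\mapsto f(x)+t$, i.e. the quotient identifying points in the same connected component of a level set, with the induced function. $U_\delta$ is a functor, there are natural isomorphisms $U_\delta U_{\delta'}\cong U_{\delta+\delta'}$, and there is a natural morphism $\zeta^\delta\colon(X,f)\to U_\delta(X,f)$, $x\mapsto[(x,0)]$. A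 $\delta$-interleaving of $(X,f)$ and $(Y,g)$ is a pair of morphisms $\alpha\colon(X,f)\to U_\delta(Y,g)$, $\beta\colon(Y,g)\to U_\delta(X,f)$ with $U_\delta(\beta)\circ\alpha=\zeta^{2\delta}$ on $(X,f)$ and $U_\delta(\alpha)\circ\beta=\zeta^{2\delta}$ on $(Y,g)$. (Equivalently, the cosheaves $I\mapsto\pi_0(f^{-1}(I))$ and $I\mapsto\pi_0(g^{-1}(I))$ on open intervals are $\delta$-interleaved.) The interleaving distance $d_I$ is the infimum of all $\delta\ge0$ for which a $\delta$-interleaving exists ($\infty$ if there are none). The induced intrinsic distance $\hat d_I$ between two $\mathbb{R}$-graphs is the infimum of the lengths (with respect to $d_I$) of all $d_I$-continuous paths of $\mathbb{R}$-graphs between them parametrized by a compact interval, where the length of a path $\gamma$ is $\sup\sum_i d_I(\gamma(t_{i-1}),\gamma(t_i))$ over all finite subdivisions of the parameter interval. *)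

(* Defs.v *)
From HB Require Import structures.
From Stdlib Require Import Relation_Operators.
From mathcomp Require Import all_boot all_order all_algebra.
From mathcomp Require Import generic_quotient lra.
From mathcomp Require Import all_classical all_reals all_analysis.

Set Implicit Arguments.
Unset Strict Implicit.
Unset Printing Implicit Defensive.

Import Order.TTheory GRing.Theory Num.Theory.
Import numFieldNormedType.Exports.

Local Open Scope classical_set_scope.
Local Open Scope ring_scope.
Local Open Scope quotient_scope.

Lemma continuous_pair2 (S T U : topologicalType) (f : S -> T) (g : S -> U) :
  continuous f -> continuous g -> continuous (fun s => (f s, g s)).
Proof.
move=> cf cg s; by apply: (cvg_pair (cf s) (cg s)).
Qed.

(** * Spaces over the real line *)

Record rspace (R : realType) := RSpace {
  carrier :> topologicalType ;
  height : carrier -> R ;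
  height_continuous : continuous height }.

Arguments height {R} r _.

Record rmor (R : realType) (X Y : rspace R) := RMor {
  rmor_fun :> X -> Y ;
  rmor_continuous : continuous rmor_fun ;
  rmor_height : forall x, height Y (rmor_fun x) = height X x }.

Definition riso (R : realType) (X Y : rspace R) : Prop :=
  exists (phi : rmor X Y) (psi : rmor Y X), cancel phi psi /\ cancel psi phi.

(** * The Reeb quotient *)

Section Reeb.
Context {R : realType}.
Implicit Types Z W : rspace R.

Definition level Z (z : Z) : set Z := height Z @^-1` [set height Z z].

Definition reeb_rel Z : rel Z :=
  fun z w => `[< connected_component (level z) z w >].

Lemma reeb_relP Z (z w : Z) :
  reflect (connected_component (level z) z w) (reeb_rel z w).
Proof. exact: asboolP. Qed.

Lemma reeb_rel_height Z (z w : Z) : reeb_rel z w -> height Z z = height Z w.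
Proof. by move=> /reeb_relP /connected_component_sub /= ->. Qed.

Lemma reeb_rel_refl Z : reflexive (@reeb_rel Z).
Proof. by move=> z; apply/reeb_relP; exact: connected_component_refl. Qed.

Lemma reeb_rel_symW Z (z w : Z) : reeb_rel z w -> reeb_rel w z.
Proof.
move=> zw; have h := reeb_rel_height zw; apply/reeb_relP.
rewrite /level -h; apply: connected_component_sym; exact/reeb_relP.
Qed.

Lemma reeb_rel_sym Z : symmetric (@reeb_rel Z).
Proof. by move=> z w; apply/idP/idP; exact: reeb_rel_symW. Qed.

Lemma reeb_rel_trans Z : transitive (@reeb_rel Z).
Proof.
move=> w z v zw wv; have h := reeb_rel_height zw; apply/reeb_relP.
apply: (connected_component_trans (y := w)); first exact/reeb_relP.
by rewrite /level h; exact/reeb_relP.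
Qed.

Canonical reeb_equiv Z : equiv_rel Z :=
  EquivRel (@reeb_rel Z) (@reeb_rel_refl Z) (@reeb_rel_sym Z)
    (@reeb_rel_trans Z).

Definition reeb_space Z : topologicalType :=
  quotient_topology {eq_quot (reeb_equiv Z)}.

Definition reeb_pi Z (z : Z) : reeb_space Z :=
  \pi_({eq_quot (reeb_equiv Z)}) z.

Definition reeb_repr Z (q : reeb_space Z) : Z :=
  repr (q : {eq_quot (reeb_equiv Z)}).

Lemma reeb_reprK Z : cancel (@reeb_repr Z) (@reeb_pi Z).
Proof. by move=> q; exact: reprK. Qed.

Lemma reeb_pi_eq Z (z w : Z) : reeb_pi z = reeb_pi w <-> reeb_rel z w.
Proof. by split=> /eqmodP. Qed.

Lemma reeb_repr_pi Z (z : Z) : reeb_rel (reeb_repr (reeb_pi z)) z.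
Proof. by apply/reeb_pi_eq; rewrite reeb_reprK. Qed.

Lemma reeb_pi_continuous Z : continuous (@reeb_pi Z).
Proof. exact: pi_continuous. Qed.

Lemma reeb_from_continuous Z (T : topologicalType) (g : reeb_space Z -> T) :
  continuous (g \o @reeb_pi Z) -> continuous g.
Proof. by move=> h; apply/quotient_continuous. Qed.

Definition reeb_height Z : reeb_space Z -> R := height Z \o @reeb_repr Z.

Lemma reeb_height_pi Z (z : Z) : reeb_height (reeb_pi z) = height Z z.
Proof. exact: reeb_rel_height (reeb_repr_pi z). Qed.

Lemma reeb_height_continuous Z : continuous (@reeb_height Z).
Proof.
apply: reeb_from_continuous.
rewrite (_ : _ \o _ = height Z); first exact: height_continuous.
by apply/funext => z /=; exact: reeb_height_pi.
Qed.

Definition reeb Z : rspace R := RSpace (@reeb_height_continuous Z).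

Section ReebMap.
Variables (Z W : rspace R) (phi : rmor Z W).

(* Defined on representatives; see [reeb_map_pi]. *)
Definition reeb_map_fun : reeb Z -> reeb W :=
  fun q => reeb_pi (phi (reeb_repr q)).

Lemma reeb_map_pi z : reeb_map_fun (reeb_pi z) = reeb_pi (phi z).
Proof.
apply/reeb_pi_eq/reeb_relP; set z' := reeb_repr _.
have /reeb_relP [B [Bz' Bl Bc] Bz] := reeb_repr_pi z; rewrite -/z' in Bz' Bl.
exists (phi @` B); last by exists z.
split; first by exists z'.
  by move=> _ [w Bw <-] /=; rewrite /level /= !rmor_height; exact: Bl.
apply: connected_continuous_connected => //.
by apply: continuous_subspaceT; exact: rmor_continuous.
Qed.

Lemma reeb_map_continuous : continuous reeb_map_fun.
Proof.
apply: reeb_from_continuous.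
rewrite (_ : _ \o _ = @reeb_pi W \o phi); last first.
  by apply/funext => z /=; exact: reeb_map_pi.
move=> z; apply: continuous_comp; first exact: rmor_continuous.
exact: reeb_pi_continuous.
Qed.

Lemma reeb_map_height q : height (reeb W) (reeb_map_fun q) = height (reeb Z) q.
Proof. by rewrite /= /reeb_map_fun reeb_height_pi rmor_height. Qed.

Definition reeb_map : rmor (reeb Z) (reeb W) :=
  RMor reeb_map_continuous reeb_map_height.

End ReebMap.

End Reeb.

(** * Smoothing *)

Section Smoothing.
Context {R : realType}.
Implicit Types (X Y : rspace R) (d : R).

Definition itvsym d : set R := `[- d, d].

Definition thick_space d X : topologicalType := (X * itvsym d)%type.

Definition thick_height d X : thick_space d X -> R :=
  fun p => height X p.1 + \val p.2.

Lemma thick_height_continuous d X : continuous (@thick_height d X).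
Proof.
move=> p; apply: (@continuousD _ _ _ (fun p : thick_space d X => height X p.1)
  (fun p : thick_space d X => \val p.2)).
  apply: (continuous_comp (f := fst) (g := height X)); first exact: cvg_fst.
  exact: height_continuous.
apply: (continuous_comp (f := snd) (g := fun t : itvsym d => \val t)).
  exact: cvg_snd.
exact: initial_continuous.
Qed.

Definition thick d X : rspace R := RSpace (@thick_height_continuous d X).

Definition smoothing d X : rspace R := reeb (thick d X).

Section SmoothingMap.
Variables (d : R) (X Y : rspace R) (phi : rmor X Y).

Definition thick_map_fun (p : thick d X) : thick d Y := (phi p.1, p.2).

Lemma thick_map_continuous : continuous thick_map_fun.
Proof.
apply: continuous_pair2; last by move=> p; exact: cvg_snd.
move=> p; apply: (continuous_comp (f := fst) (g := phi)); first exact: cvg_fst.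
exact: rmor_continuous.
Qed.

Lemma thick_map_height p :
  height (thick d Y) (thick_map_fun p) = height (thick d X) p.
Proof. by rewrite /= /thick_height /= rmor_height. Qed.

Definition smoothing_map : rmor (smoothing d X) (smoothing d Y) :=
  reeb_map (RMor thick_map_continuous thick_map_height).

End SmoothingMap.

Lemma itvsym0 d : 0 <= d -> 0 \in itvsym d.
Proof. by move=> d0; apply/mem_set; rewrite /itvsym /= in_itv /= oppr_le0 d0. Qed.

Definition itvsym_zero d (d0 : 0 <= d) : itvsym d := SigSub (itvsym0 d0).

Definition zeta d (d0 : 0 <= d) X : X -> smoothing d X :=
  fun x => reeb_pi ((x, itvsym_zero d0) : thick d X).

Lemma itvsymD d d' (t : itvsym d) (s : itvsym d') :
  \val t + \val s \in itvsym (d + d').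
Proof.
case: t s => [t /= /set_mem + ] [s /= /set_mem].
rewrite /itvsym /= !in_itv /= => /andP[s1 s2] /andP[t1 t2].
by apply/mem_set; rewrite /= in_itv /= opprD !lerD.
Qed.

Definition itvsym_add d d' (t : itvsym d) (s : itvsym d') : itvsym (d + d') :=
  SigSub (itvsymD t s).

(* The natural isomorphism [([(x, t)], s)] |-> [(x, t + s)]. It is defined on
   representatives; [smoothing_comp_pi] shows independence of the choice. *)
Definition smoothing_comp d d' X :
    smoothing d' (smoothing d X) -> smoothing (d + d') X :=
  fun q => let: (p, s) := reeb_repr q in let: (x, t) := reeb_repr p in
  reeb_pi ((x, itvsym_add t s) : thick (d + d') X).


(* Reeb projections are monotone quotient maps, so they pull closed connected
   sets back to connected sets. *)
Lemma reeb_pi_connected (Z : rspace R) (B : set (reeb Z)) :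
  closed B -> connected B -> connected (@reeb_pi R Z @^-1` B).
Proof.
move=> clB; rewrite !connectedP => cB E [E0 BE sepE]; set q := @reeb_pi R Z.
have hC (z : Z) : connected [set w | reeb_rel z w].
  rewrite (_ : [set w | _] = connected_component (level z) z); last first.
    by apply/funext => w; apply/propext; split => /reeb_relP.
  exact: component_connected.
have EB b : E b `<=` q @^-1` B.
  by rewrite BE; case: b => z Ez; [right|left].
have satE b z w : E b z -> q w = q z -> E b w.
  move=> Ez /esym /reeb_pi_eq zw.
  have /(connected_subset sepE) : [set w | reeb_rel z w] `<=` E false `|` E true.
    rewrite -BE => v /= /reeb_pi_eq qv; move: (EB _ _ Ez) => /=.
    by rewrite /q -qv.
  have /disjoints_subset dj := separated_disjoint sepE.
  move=> /(_ (hC z)) []; move: b Ez => [] Ez h; have := h _ zw => // _.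
    by case: (dj _ (h z (reeb_rel_refl z)) Ez).
  by case: (dj _ Ez (h z (reeb_rel_refl z))).
have clE b : closed (E b).
  have clU : closed (q @^-1` B).
    by apply: closed_comp clB => z _; exact: reeb_pi_continuous.
  move=> z clz; have := closureS (EB b) clz; rewrite -(closure_id _).1//.
  rewrite BE; case: sepE => [s1 s2]; case: b clz => clz [] Ez //.
    by have : (E false `&` closure (E true)) z by []; rewrite s2.
  by have : (closure (E false) `&` E true) z by []; rewrite s1.
have qE b : q @^-1` (q @` E b) = E b.
  apply/seteqP; split => [z [w Ew wz]|z Ez]; last by exists z.
  exact: satE Ew (esym wz).
have clqE b : closed (q @` E b).
  rewrite -openC /open /= /quotient_open -preimage_setC.
  have := clE b; rewrite -openC -{1}(qE b); exact.
apply: (cB (fun b => q @` E b)); split.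
- by move=> b; have [z Ez] := E0 b; exists (q z), z.
- apply/seteqP; split => [y By|y [] [z Ez <-]]; last 2 first.
  + exact: EB Ez.
  + exact: EB Ez.
  have : (q @^-1` B) (reeb_repr y) by rewrite /q /= reeb_reprK.
  by rewrite BE => -[] Ey; [left|right]; exists (reeb_repr y) => //;
    rewrite /q reeb_reprK.
have dj : q @` E false `&` q @` E true = set0.
  apply/seteqP; split => // y [[z Ez <-]] [w Ew wz].
  have := separated_disjoint sepE; have Ew' := satE _ _ _ Ez wz.
  by move=> /seteqP [/(_ w) + _]; apply.
by split; rewrite -(closure_id _).1.
Qed.

Definition clamp d (u : R) : R := Num.max (- d) (Num.min u d).

Lemma clamp_subproof d (d0 : 0 <= d) (u : R) : clamp d u \in itvsym d.
Proof.
apply/mem_set; rewrite /itvsym /clamp /= in_itv /=.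
by rewrite le_max lexx /= ge_max ge_min lexx orbT andbT -subr_ge0 opprK addr_ge0.
Qed.

Definition clampS d (d0 : 0 <= d) (u : R) : itvsym d :=
  SigSub (clamp_subproof d0 u).

Lemma clampS_continuous d (d0 : 0 <= d) : continuous (clampS d0).
Proof.
apply: (@continuous_comp_initial _ _ _ _ (clampS d0)).
move=> u; apply: (continuous_max (f := cst (- d)) (g := idfun \min cst d)).
  exact: cst_continuous.
by apply: continuous_min; [exact: cvg_id|exact: cst_continuous].
Qed.

Lemma clampS_id d (d0 : 0 <= d) (t : itvsym d) : clampS d0 (\val t) = t.
Proof.
apply/val_inj => /=; case: t => t /= /set_mem; rewrite /itvsym /= in_itv /=.
by rewrite /clamp => /andP[t1 t2]; rewrite (min_idPl t2) (max_idPr t1).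
Qed.

Lemma itvsym_ge0 d (t : itvsym d) : 0 <= d.
Proof.
case: t => t /= /set_mem; rewrite /itvsym /= in_itv /= => /andP[t1 t2].
by have := le_trans t1 t2; lra.
Qed.

Lemma smoothing_comp_pi d d' X (x : X) (t : itvsym d) (s : itvsym d') :
  smoothing_comp (reeb_pi ((reeb_pi ((x, t) : thick d X), s) :
    thick d' (smoothing d X))) =
  reeb_pi ((x, itvsym_add t s) : thick (d + d') X).
Proof.
rewrite /smoothing_comp; set p0 := reeb_pi ((x, t) : thick d X).
set q0 := reeb_pi ((p0, s) : thick d' (smoothing d X)).
have /reeb_relP := reeb_repr_pi ((p0, s) : thick d' (smoothing d X)).
rewrite -/q0; case: (reeb_repr q0) => [p1 s1] ps1.
case E1 : (reeb_repr p1) => [x1 t1].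
have p1E : p1 = reeb_pi ((x1, t1) : thick d X) by rewrite -E1 reeb_reprK.
have d0 := itvsym_ge0 t; have d'0 := itvsym_ge0 s.
have dd0 : 0 <= d + d' by exact: addr_ge0.
pose c := height X x1 + \val t1 + \val s1.
have hp1 (y : X) (u : itvsym d) :
    height (smoothing d X) (reeb_pi ((y, u) : thick d X)) = height X y + \val u.
  exact: reeb_height_pi.
set L := level _ in ps1.
pose D := connected_component L (p1, s1).
have LE r : L r -> height (smoothing d X) r.1 + \val r.2 = c.
  by move=> h; rewrite /c -hp1 -p1E; exact: h.
have clL : closed L.
  apply: closed_comp; first by move=> r _; exact: height_continuous.
  exact: closed_eq.
have clD : closed D by exact: component_closed.
have cD : connected D by exact: component_connected.
pose B := fst @` D : set (smoothing d X).
have cB : connected B.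
  apply: connected_continuous_connected cD _.
  by apply: continuous_subspaceT => r; exact: cvg_fst.
have cDp : D (p0, s) by [].
have cDp1 : D (p1, s1) by exact: connected_component_refl.
have DL : D `<=` L by exact: connected_component_sub.
(* On the level set the second coordinate is determined by the first one. *)
have secE r : L r -> r.2 = clampS d'0 (c - height (smoothing d X) r.1).
  by move=> /LE <-; rewrite addrAC subrr add0r clampS_id.
pose sec (p : smoothing d X) : thick d' (smoothing d X) :=
  (p, clampS d'0 (c - height (smoothing d X) p)).
have sec_cont : continuous sec.
  apply: continuous_pair2; first by move=> p; exact: cvg_id.
  move=> p; apply: continuous_comp; last exact: clampS_continuous.
  by apply: continuousB; [exact: cst_continuous|exact: height_continuous].
have BE : B = sec @^-1` D.
  apply/seteqP; split=> [p [r Dr <-]|p Dp]; last by exists (sec p).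
  by rewrite /= /sec -(secE _ (DL _ Dr)) -surjective_pairing.
have clB : closed B.
  by rewrite BE; apply: closed_comp clD => p _; exact: sec_cont.
have cA := reeb_pi_connected clB cB; set A := _ @^-1` B in cA.
pose g (p : thick d X) : thick (d + d') X :=
  (p.1, clampS dd0 (c - height X p.1)).
have g_cont : continuous g.
  apply: continuous_pair2; first by move=> p; exact: cvg_fst.
  move=> p; apply: continuous_comp; last exact: clampS_continuous.
  apply: continuousB; first exact: cst_continuous.
  apply: (continuous_comp (f := fst) (g := height X)); first exact: cvg_fst.
  exact: height_continuous.
have gE y (u : itvsym d) (v : itvsym d') :
    L (reeb_pi ((y, u) : thick d X), v) -> g (y, u) = (y, itvsym_add u v).
  move=> /LE; rewrite hp1 /g => <-; congr (_, _).
  rewrite -(clampS_id dd0 (itvsym_add u v)) /=; congr clampS.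
  by rewrite /=; lra.
apply/reeb_pi_eq/reeb_relP; exists (g @` A); last first.
  exists (x, t); first by exists (p0, s).
  exact: gE (DL _ cDp).
split.
- exists (x1, t1); first by exists (p1, s1) => //=; rewrite p1E.
  by apply: gE; rewrite -p1E; exact: DL.
- move=> _ [[y u] [[p v] Dr /= pE] <-]; have := DL _ Dr; rewrite pE => Lr.
  rewrite (gE _ _ _ Lr) /level /= /thick_height /=.
  by have := LE _ Lr; rewrite hp1 /c /=; lra.
- apply: connected_continuous_connected cA _.
  by apply: continuous_subspaceT.
Qed.

End Smoothing.

(** * R-graphs *)

Section RGraph.
Context {R : realType}.

Record graph_data := GraphData {
  gd_n : nat ;
  gd_a : 'I_gd_n.+1 -> R ;
  gd_a_lt : forall i j : 'I_gd_n.+1, (i < j)%N -> gd_a i < gd_a j ;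
  gd_V : 'I_gd_n.+1 -> finType ;
  gd_E : 'I_gd_n -> finType ;
  gd_l : forall i : 'I_gd_n, gd_E i -> gd_V (widen_ord (leqnSn gd_n) i) ;
  gd_r : forall i : 'I_gd_n, gd_E i -> gd_V (lift ord0 i) }.

Variable D : graph_data.

Definition gd_lo (i : 'I_(gd_n D)) : R := gd_a (widen_ord (leqnSn (gd_n D)) i).
Definition gd_hi (i : 'I_(gd_n D)) : R := gd_a (lift ord0 i).

(* The disjoint union of the [V_i * {a_i}] and the [E_i * [a_i, a_(i+1)]] is
   written as a coproduct of one closed interval per vertex or edge; the
   interval of a vertex is the point [[a_i, a_i]]. *)
Definition gd_piece : finType :=
  ({i : 'I_(gd_n D).+1 & gd_V i} + {i : 'I_(gd_n D) & gd_E i})%type.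

Definition gd_vertex (i : 'I_(gd_n D).+1) (v : gd_V i) : gd_piece :=
  inl (existT (fun i => gd_V i : Type) i v).
Definition gd_edge (i : 'I_(gd_n D)) (e : gd_E i) : gd_piece :=
  inr (existT (fun i => gd_E i : Type) i e).

Definition gd_itv (k : gd_piece) : set R :=
  match k with
  | inl v => `[gd_a (tag v), gd_a (tag v)]
  | inr e => `[gd_lo (tag e), gd_hi (tag e)]
  end.

Definition gd_total : topologicalType := {k : gd_piece & gd_itv k}.

Definition gd_proj (p : gd_total) : R := \val (tagged p).

Lemma gd_proj_continuous : continuous gd_proj.
Proof.
move=> [k x] U nU; have := @initial_continuous _ R (set_val : gd_itv k -> R) x.
move=> /(_ U nU).
exact: (@existT_continuous _ (fun k => gd_itv k : topologicalType) k x).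
Qed.

Inductive gd_glue (p q : gd_total) : Prop :=
| GlueLeft (i : 'I_(gd_n D)) (e : gd_E i) of
    tag p = gd_edge e & gd_proj p = gd_lo i &
    tag q = gd_vertex (gd_l e)
| GlueRight (i : 'I_(gd_n D)) (e : gd_E i) of
    tag p = gd_edge e & gd_proj p = gd_hi i &
    tag q = gd_vertex (gd_r e).

Definition gd_rel : rel gd_total :=
  fun p q => `[< clos_refl_sym_trans gd_total gd_glue p q >].

Lemma gd_relP p q :
  reflect (clos_refl_sym_trans gd_total gd_glue p q) (gd_rel p q).
Proof. exact: asboolP. Qed.

Lemma gd_rel_refl : reflexive gd_rel.
Proof. by move=> p; apply/gd_relP; exact: rst_refl. Qed.

Lemma gd_rel_sym : symmetric gd_rel.
Proof.
by move=> p q; apply/idP/idP => /gd_relP pq; apply/gd_relP; exact: rst_sym.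
Qed.

Lemma gd_rel_trans : transitive gd_rel.
Proof.
move=> q p r /gd_relP pq /gd_relP qr; apply/gd_relP; exact: rst_trans pq qr.
Qed.

Canonical gd_equiv : equiv_rel gd_total :=
  EquivRel gd_rel gd_rel_refl gd_rel_sym gd_rel_trans.

Lemma gd_rel_proj p q : gd_rel p q -> gd_proj p = gd_proj q.
Proof.
have vertexE v t : tag t = inl v -> gd_proj t = gd_a (tag v).
  case: t => k t /= kE; subst k; case: t => t tv; move: (set_mem tv).
  by rewrite /= in_itv /= => /le_anti.
move=> /gd_relP pq; elim: p q / pq => [p q|//|p q _ ->//|p q r _ -> _ ->//].
by case=> i e _ -> /vertexE ->.
Qed.

Definition gd_space : topologicalType :=
  quotient_topology {eq_quot gd_equiv}.

Definition gd_height : gd_space -> R :=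
  gd_proj \o (repr : {eq_quot gd_equiv} -> gd_total).

Lemma gd_height_continuous : continuous gd_height.
Proof.
apply: (repr_comp_continuous gd_proj_continuous) => p q /eqP /eqmodP pq.
by apply/eqP; exact: gd_rel_proj.
Qed.

Definition gd_rspace : rspace R := RSpace gd_height_continuous.

End RGraph.

Arguments graph_data : clear implicits.

Record Rgraph (R : realType) := RGraph {
  Rgraph_rspace :> rspace R ;
  Rgraph_iso : exists D : graph_data R, riso Rgraph_rspace (gd_rspace D) }.

(** * Interleaving distance and its intrinsic version *)

Section Distances.
Context {R : realType}.
Implicit Types X Y : Rgraph R.

Definition interleaving (d : R) (d0 : 0 <= d) (X Y : rspace R)
    (alpha : rmor X (smoothing d Y)) (beta : rmor Y (smoothing d X)) : Prop :=
  (forall x, smoothing_comp (smoothing_map d beta (alpha x)) =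
             zeta (addr_ge0 d0 d0) x) /\
  (forall y, smoothing_comp (smoothing_map d alpha (beta y)) =
             zeta (addr_ge0 d0 d0) y).

Definition interleaved (d : R) (X Y : rspace R) : Prop :=
  exists (d0 : 0 <= d) (alpha : rmor X (smoothing d Y))
         (beta : rmor Y (smoothing d X)), interleaving d0 alpha beta.

Local Open Scope ereal_scope.

Definition d_I X Y : \bar R :=
  ereal_inf [set d%:E | d in [set d | interleaved d X Y]].

Definition path_continuous (a b : R) (gamma : R -> Rgraph R) : Prop :=
  forall t, t \in `[a, b] -> forall e : R, (0 < e)%R ->
  exists2 eta : R, (0 < eta)%R &
    forall s, s \in `[a, b] -> (`|s - t| < eta)%R ->
      d_I (gamma t) (gamma s) < e%:E.

(* Sum over the consecutive points of the subdivision [a :: s]. *)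
Definition path_variation (a : R) (gamma : R -> Rgraph R) (s : seq R) : \bar R :=
  \sum_(i < size s) d_I (gamma (nth a (a :: s) i)) (gamma (nth a s i)).

Definition path_length (a b : R) (gamma : R -> Rgraph R) : \bar R :=
  ereal_sup [set path_variation a gamma s | s in itv_partition a b].

(* Paths are given as functions on R, of which only the restriction to the
   parameter interval [[a, b]] matters. *)
Definition hat_d_I X Y : \bar R :=
  ereal_inf [set L | exists a b (gamma : R -> Rgraph R),
    [/\ (a <= b)%R, gamma a = X, gamma b = Y, path_continuous a b gamma &
        L = path_length a b gamma]].

End Distances.

(* Main.v *)
Require Import Defs.
From mathcomp Require Import all_boot all_order all_algebra.
From mathcomp Require Import all_classical all_reals all_analysis.
From mathcomp Require Import generic_quotient lra.
From Stdlib Require Import Relation_Operators.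

(** The two R-graphs that force the factor 2 are a circle and a segment, both
of height 4 (two vertices, joined by two edges or by one).

They are 1-interleaved. Collapse the circle onto the segment and embed the
segment as one of the two edges. The round trip on the circle moves a point to
the point of the same height [h] on that edge. In the 2-smoothing all points
of the same height agree: within the heights [[h - 2, h + 2]] one can walk along both
edges to the bottom vertex if [h <= 2], to the top vertex otherwise
([zeta_pencil_edge], [pencil_interleaved]).

Along a path, however, the circle can only be removed by shrinking it
gradually, and this costs 2. The quantity to follow is the height of the
tallest cycle. It is measured through degree-one cohomology: by Mayer-Vietoris,
cycles that pass entirely through the slice of heights [(p, q)] are detected by
the locally constant functions to Z/2 on the slice that are not a sum of one on
the part above [p] and one on the part below [q]; [decomposes X p q] says that
there are none. Two facts govern this property.

First, by gluing, a decomposition over a smaller slice of a function given on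
[(p, q)] extends to [(p, q)] ([decomposition_extends]). Secondly, functions can
be pulled back along the morphisms of a [d]-interleaving, losing [d] at each
end of the slice, and the round trip is the restriction ([pullbackK]). So a
function on the slice [(p, q)] of X can be carried to the slice
[(p + d, q - d)] of Y, decomposed there, carried back to [(p + 2d, q - 2d)] and
extended to [(p, q)], provided that [q - p > 4d] ([interleaved_decomposes]).
The extension step is what makes a step of length [d] cost only [d] at each
end: as soon as all slices of Y wider than [w >= 2d] decompose, all slices of X
wider than [w + 2d] do.

On a path from the circle to the segment, subdivide so finely that all steps
are shorter than [e] ([fine_chain]). All slices of the segment decompose, so by
induction from that end all slices of the circle wider than [2e + 2v]
decompose, where [v] is the sum of the steps ([decomposes_wider_chain]). The
slice [(0, 4)] of the circle does not ([circle_not_decomposes]), whence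
[v >= 2 - e]. Therefore the intrinsic distance is at least 2, while the
interleaving distance is at most 1. *)

Set Implicit Arguments.
Unset Strict Implicit.
Unset Printing Implicit Defensive.

Import Order.TTheory GRing.Theory Num.Theory.
Import numFieldNormedType.Exports.

Local Open Scope classical_set_scope.
Local Open Scope ring_scope.

(** * Locally constant functions *)

(** The function is defined everywhere and only its values near [A] matter; for
open [A] this is local constancy on the subspace [A]. Total functions avoid
subspace types when restricting to slices. *)
Definition locally_constant (T : topologicalType) (A : set T) (phi : T -> bool) :=
  forall x, A x -> \forall y \near x, phi y = phi x.

Lemma locally_constantS (T : topologicalType) (A B : set T) (phi : T -> bool) :
  A `<=` B -> locally_constant B phi -> locally_constant A phi.
Proof. by move=> AB lc x Ax; exact: lc (AB _ Ax). Qed.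

Lemma locally_constant_comp (S T : topologicalType) (g : S -> T)
    (A : set S) (B : set T) (phi : T -> bool) :
  continuous g -> (forall s, A s -> B (g s)) ->
  locally_constant B phi -> locally_constant A (phi \o g).
Proof. by move=> cg AB lc s As; exact: (cg s _ (lc _ (AB _ As))). Qed.

Lemma locally_constant_cst (T : topologicalType) (A : set T) (b : bool) :
  locally_constant A (fun=> b).
Proof. by move=> x _; apply: nearW. Qed.

Lemma locally_constant_connected (T : topologicalType) (A : set T)
    (phi : T -> bool) x y :
  connected A -> locally_constant A phi -> A x -> A y -> phi x = phi y.
Proof.
move=> cA lc Ax Ay.
pose B := A `&` [set z | phi z = phi x].
suff BA : B = A by move: Ay; rewrite -BA => -[_ ->].
apply: cA; first by exists x.
- exists (interior [set z | phi z = phi x]); first exact: open_interior.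
  apply/seteqP; split=> z [Az pz]; split => //.
    by have := lc z Az; rewrite pz.
  exact: (interior_subset pz).
- exists (~` interior [set z | phi z != phi x]).
    by rewrite closedC; exact: open_interior.
  apply/seteqP; split=> z [Az pz]; split => //.
    by move/interior_subset => /=; rewrite pz eqxx.
  apply/eqP/negPn/negP => nz; apply: pz.
  by apply: filterS (lc z Az) => w /= ->.
Qed.

(** * Slices and smoothings *)

Definition slice (R : realType) (X : rspace R) (I : set R) : set X :=
  height X @^-1` I.
Arguments slice {R} X I.

Lemma slice_open (R : realType) (X : rspace R) (I : set R) :
  open I -> open (slice X I).
Proof.
by move=> oI; apply: open_comp oI => x _; exact: height_continuous.
Qed.

(** The chosen representative lies in the same connected component of the level
set, which is contained in the slice. *)
Lemma locally_constant_reeb (R : realType) (Z : rspace R) (I : set R)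
    (phi : Z -> bool) z :
  locally_constant (slice Z I) phi -> slice Z I z ->
  phi (reeb_repr (reeb_pi z)) = phi z.
Proof.
move=> lc Iz; have zz := reeb_repr_pi z; have hz := reeb_rel_height zz.
have /reeb_relP C := zz.
apply: (locally_constant_connected _ _ _ C).
- exact: component_connected.
- apply: locally_constantS lc => w /connected_component_sub.
  by rewrite /level /slice /= => ->; rewrite hz.
- exact: connected_component_refl.
Qed.

Lemma slice_reeb_pi (R : realType) (Z : rspace R) (I : set R) (z : Z) :
  slice (reeb Z) I (reeb_pi z) = slice Z I z.
Proof. by rewrite /slice /preimage /mkset /= reeb_height_pi. Qed.

(** The set where the function takes a given value over [I] is open because
its preimage in [Z] is: the preimage consists of whole classes of the Reeb
relation, so choosing representatives does not disturb it. *)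
Lemma locally_constant_reeb_repr (R : realType) (Z : rspace R) (I : set R)
    (phi : Z -> bool) :
  open I -> locally_constant (slice Z I) phi ->
  locally_constant (slice (reeb Z) I) (phi \o @reeb_repr R Z).
Proof.
move=> oI lc q Iq; set b := (_ \o _) q.
pose A := [set r | slice (reeb Z) I r /\ phi (reeb_repr r) = b].
have oA : open A.
  suff : open (@reeb_pi R Z @^-1` A) by [].
  rewrite openE => z [Iz pz]; have {}Iz : slice Z I z.
    by rewrite -slice_reeb_pi.
  have nI : \forall w \near z, slice Z I w.
    by apply: open_nbhs_nbhs; split; first exact: slice_open.
  apply: filterS2 nI (lc z Iz) => w Iw pw; split.
    by rewrite slice_reeb_pi.
  by rewrite (locally_constant_reeb lc)// pw -(locally_constant_reeb lc).
by apply: filterS (open_nbhs_nbhs (conj oA (conj Iq erefl))) => r [].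
Qed.

(** [J] contains the [d]-thickening of [I]: the heights of the points of [Y]
that are seen by the [d]-smoothing of [Y] over [I]. *)
Definition thickens (R : realType) (d : R) (I J : set R) :=
  forall r t, I r -> - d <= t <= d -> J (r + t).

(** On slices where [psi] is locally constant, the value does not depend on
the representative, by [locally_constant_reeb]. *)
Definition pullback (R : realType) (d : R) (X Y : rspace R)
    (alpha : rmor X (smoothing d Y)) (psi : Y -> bool) : X -> bool :=
  fun x => psi (reeb_repr (alpha x)).1.

Lemma itvsymP (R : realType) (d : R) (t : itvsym d) : - d <= \val t <= d.
Proof. by case: t => t /= /set_mem; rewrite /itvsym /= in_itv. Qed.

Lemma thick_locally_constant (R : realType) (d : R) (Y : rspace R)
    (I J : set R) (psi : Y -> bool) :
  thickens d I J -> locally_constant (slice Y J) psi ->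
  locally_constant (slice (thick d Y) I) (psi \o fst).
Proof.
move=> IJ; apply: locally_constant_comp; first by move=> p; exact: cvg_fst.
move=> [y t]; rewrite /slice /= /thick_height /= => Iyt.
have -> : height Y y = height Y y + \val t + - \val t by rewrite addrK.
by apply: IJ => //; move: (itvsymP t); lra.
Qed.

Lemma pullback_locally_constant (R : realType) (d : R) (X Y : rspace R)
    (alpha : rmor X (smoothing d Y)) (I J : set R) (psi : Y -> bool) :
  open I -> thickens d I J -> locally_constant (slice Y J) psi ->
  locally_constant (slice X I) (pullback alpha psi).
Proof.
move=> oI IJ lc.
have := locally_constant_reeb_repr oI (thick_locally_constant IJ lc).
apply: locally_constant_comp; first exact: rmor_continuous.
by move=> x; rewrite /slice /preimage /mkset rmor_height.
Qed.

(** If [alpha x] is the class of [(y, t)] and [beta y] that of [(x', t')], the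
interleaving identity says that [(x', t' + t)] and [(x, 0)] lie in one
component of a level set of the [2d]-thickening of [X], on which
[phi] is constant. *)
Lemma pullbackK (R : realType) (d : R) (d0 : 0 <= d) (X Y : rspace R)
    (alpha : rmor X (smoothing d Y)) (beta : rmor Y (smoothing d X))
    (I J : set R) (phi : X -> bool) x :
  smoothing_comp (smoothing_map d beta (alpha x)) = zeta (addr_ge0 d0 d0) x ->
  thickens (d + d) I J -> locally_constant (slice X J) phi -> slice X I x ->
  pullback alpha (pullback beta phi) x = phi x.
Proof.
move=> ab IJ lc Ix; rewrite /pullback.
case E : (reeb_repr (alpha x)) => [y t] /=.
case F : (reeb_repr (beta y)) => [x' t'] /=.
move: ab; rewrite -[alpha x]reeb_reprK E.
rewrite [smoothing_map _ _ _]reeb_map_pi /= /thick_map_fun /=.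
rewrite -[beta y]reeb_reprK F smoothing_comp_pi => ab.
have lct := thick_locally_constant IJ lc.
have h : slice (thick (d + d) X) I (x, itvsym_zero (addr_ge0 d0 d0)).
  by rewrite /slice /= /thick_height /= addr0.
have := locally_constant_reeb lct h.
rewrite -/(zeta _ _) -ab (locally_constant_reeb lct) //.
by rewrite -slice_reeb_pi ab [zeta _ _]/(reeb_pi _) slice_reeb_pi.
Qed.

(** * Decompositions over slices *)

(** Boolean values with [(+)] stand for Z/2. *)
Definition splits (R : realType) (X : rspace R) (p q : R) (phi : X -> bool) :=
  exists u v, [/\ locally_constant (slice X `]p, +oo[) u,
    locally_constant (slice X `]-oo, q[) v &
    forall x, slice X `]p, q[ x -> phi x = u x (+) v x].

(** In terms of the Mayer-Vietoris sequence of the parts above [p] and below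
[q]: the connecting map from H^0 of the slice to H^1 of [X] vanishes. *)
Definition decomposes (R : realType) (X : rspace R) (p q : R) :=
  forall phi, locally_constant (slice X `]p, q[) phi -> splits p q phi.

Lemma addb_locally_constant (T : topologicalType) (A B : set T) phi psi :
  locally_constant A phi -> locally_constant B psi ->
  locally_constant (A `&` B) (fun x => phi x (+) psi x).
Proof.
move=> lA lB x [Ax Bx].
by apply: filterS2 (lA x Ax) (lB x Bx) => y -> ->.
Qed.

(** Below [q'] both [phi] and [v] are available down to the height [p], so
[phi (+) v] continues [u] downwards; symmetrically, [phi (+) u] continues [v]
upwards. *)
Lemma decomposition_extends (R : realType) (X : rspace R) (p p' q' q : R) phi :
  p <= p' -> p' < q' -> q' <= q ->
  locally_constant (slice X `]p, q[) phi ->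
  splits p' q' phi -> splits p q phi.
Proof.
move=> pp' p'q' q'q lphi [u [v [lu lv uv]]].
exists (fun x => if p' < height X x then u x else phi x (+) v x).
exists (fun x => if height X x < q' then v x else phi x (+) u x).
have near_slice I x : open I -> slice X I x -> \forall y \near x, slice X I y.
  by move=> oI Ix; apply: open_nbhs_nbhs; split; first exact: slice_open.
have uvx x : p' < height X x -> height X x < q' -> phi x = u x (+) v x.
  by move=> h1 h2; apply: uv; rewrite /slice /= in_itv /= h1 h2.
split.
- move=> x; rewrite /slice /= in_itv /= andbT => px.
  have [p'x|xp'] := ltP.
    have hx : slice X `]p', +oo[ x by rewrite /slice /= in_itv /= p'x.
    apply: filterS2 (near_slice _ _ (interval_open _ _) hx) (lu x hx) => //.
    by move=> y; rewrite /slice /= in_itv /= andbT => ->.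
  have hx : slice X `]p, q'[ x.
    by rewrite /slice /= in_itv /= px /=; exact: le_lt_trans p'q'.
  have h := addb_locally_constant lphi lv.
  apply: filterS2 (near_slice _ _ (interval_open _ _) hx) (h x _) => //.
    move=> y; rewrite /slice /= in_itv /= => /andP[_ yq'] <-.
    by case: ifP => // p'y; rewrite (uvx _ p'y yq') -addbA addbb addbF.
  by move: hx; rewrite /slice /= !in_itv /= => /andP[-> xq']; split => //; lra.
- move=> x; rewrite /slice /= in_itv /= => xq.
  have [xq'|q'x] := ltP.
    have hx : slice X `]-oo, q'[ x by rewrite /slice /= in_itv /= xq'.
    apply: filterS2 (near_slice _ _ (interval_open _ _) hx) (lv x hx) => //.
    by move=> y; rewrite /slice /= in_itv /= => ->.
  have hx : slice X `]p', q[ x.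
    by rewrite /slice /= in_itv /= xq andbT; exact: lt_le_trans q'x.
  have h := addb_locally_constant lphi lu.
  apply: filterS2 (near_slice _ _ (interval_open _ _) hx) (h x _) => //.
    move=> y; rewrite /slice /= in_itv /= => /andP[p'y _] <-.
    by case: ifP => // yq'; rewrite (uvx _ p'y yq') addbAC addbb addFb.
  by move: hx; rewrite /slice /= !in_itv /= => /andP[p'x ->]; split => //; lra.
- move=> x; rewrite /slice /= in_itv /= => /andP[px xq].
  have [p'x|xp'] := ltP p'; have [xq'|q'x] := ltP _ q'; first exact: uvx.
  + by rewrite addbC -addbA addbb addbF.
  + by rewrite -addbA addbb addbF.
  + by move: (lt_le_trans p'q' (le_trans q'x xp')); rewrite ltxx.
Qed.

(** Pull [phi] back to [Y] along [beta], decompose there, pull the two summands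
back along [alpha] and extend. The extension needs the slice
[(p + 2d, q - 2d)] to be nonempty, whence the bound [4d]. *)
Lemma interleaved_decomposes (R : realType) (d : R) (X Y : rspace R) (p q : R) :
  interleaved d X Y -> d *+ 4 < q - p ->
  decomposes Y (p + d) (q - d) -> decomposes X p q.
Proof.
move=> [d0 [alpha [beta [ab _]]]] dpq dec phi lphi.
have [|u [v [lu lv uv]]] := dec (pullback beta phi).
  apply: pullback_locally_constant lphi; first exact: interval_open.
  move=> r t; rewrite /= !in_itv /= => /andP[? ?] /andP[? ?].
  by apply/andP; split; lra.
apply: (@decomposition_extends _ _ p (p + d + d) (q - d - d) q) => //; try lra.
exists (pullback alpha u), (pullback alpha v); split.
- apply: pullback_locally_constant lu; first exact: interval_open.
  move=> r t; rewrite /= !in_itv /= !andbT => ? /andP[? ?]; lra.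
- apply: pullback_locally_constant lv; first exact: interval_open.
  move=> r t; rewrite /= !in_itv /= => ? /andP[? ?]; lra.
- move=> x Ix.
  rewrite -(pullbackK (ab x) _ lphi Ix); last first.
    move=> r t; rewrite /= !in_itv /= => /andP[? ?] /andP[? ?].
    by apply/andP; split; lra.
  apply: uv; rewrite /slice /=.
  set p0 := reeb_repr _.
  have : reeb_height (alpha x) = height Y p0.1 + \val p0.2.
    by rewrite -[alpha x]reeb_reprK; exact: reeb_height_pi.
  rewrite -[reeb_height _]/(height (smoothing d Y) _) rmor_height.
  move: Ix (itvsymP p0.2).
  rewrite /slice /= !in_itv /= => /andP[? ?] /andP[? ?] ?.
  by apply/andP; split; lra.
Qed.

(** * Continuous paths of R-graphs *)

Definition decomposes_wider (R : realType) (X : rspace R) (w : R) :=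
  forall p q, w < q - p -> decomposes X p q.

Lemma interleaved_sym (R : realType) (d : R) (X Y : rspace R) :
  interleaved d X Y -> interleaved d Y X.
Proof. by move=> [d0 [alpha [beta [ab ba]]]]; exists d0, beta, alpha. Qed.

Lemma d_I_sym (R : realType) (X Y : Rgraph R) : d_I X Y = d_I Y X.
Proof.
congr ereal_inf; apply/seteqP.
by split=> _ [d /interleaved_sym di <-]; exists d.
Qed.

Lemma d_I_ge0 (R : realType) (X Y : Rgraph R) : (0 <= d_I X Y)%E.
Proof. by apply: le_ereal_inf_tmp => _ [d [d0 _] <-]; rewrite lee_fin. Qed.

Lemma d_I_lt_interleaved (R : realType) (X Y : Rgraph R) (e : R) :
  (d_I X Y < e%:E)%E -> exists2 d, d < e & interleaved d X Y.
Proof.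
by move=> /ereal_inf_lt [_ [d di <-]]; rewrite lte_fin => de; exists d.
Qed.

(** The distance is an infimum, so the interleavings at hand may have
parameters slightly above it; the strict inequalities in [d *+ 2 < w] and in
[decomposes_wider] leave room for this. *)
Lemma decomposes_wider_d_I (R : realType) (X Y : Rgraph R) (w d : R) :
  (d_I X Y <= d%:E)%E -> d *+ 2 < w ->
  decomposes_wider Y w -> decomposes_wider X (w + d *+ 2).
Proof.
move=> XYd dw Yw p q pq.
pose e := Num.min (w / 2) ((q - p - w) / 2).
have [|d' d'e XYd'] := @d_I_lt_interleaved _ X Y e.
  by apply: le_lt_trans XYd _; rewrite lte_fin lt_min; apply/andP; split; lra.
move: d'e; rewrite lt_min => /andP[d'w d'pq].
by apply: (interleaved_decomposes XYd'); [lra|apply: Yw; lra].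
Qed.

Fixpoint d_I_chain (R : realType) (gamma : R -> Rgraph R) (e a : R) (s : seq R)
    : bool :=
  if s is x :: s' then
    (d_I (gamma a) (gamma x) < e%:E)%E && d_I_chain gamma e x s'
  else true.

Lemma d_I_chain_rcons (R : realType) (gamma : R -> Rgraph R) (e a x : R) (s : seq R) :
  d_I_chain gamma e a (rcons s x) =
  d_I_chain gamma e a s && (d_I (gamma (last a s)) (gamma x) < e%:E)%E.
Proof. by elim: s a => [|y s IH] a /=; rewrite ?andbT // IH andbA. Qed.

Lemma path_variation_cons (R : realType) (gamma : R -> Rgraph R) (a x : R) (s : seq R) :
  path_variation a gamma (x :: s) =
  (d_I (gamma a) (gamma x) + path_variation x gamma s)%E.
Proof.
rewrite /path_variation /= big_ord_recl /=; congr (_ + _)%E.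
apply: eq_bigr => i _; rewrite add0n.
by congr (d_I (gamma _) (gamma _)); apply: set_nth_default; rewrite /= ?ltnS // ltnW.
Qed.

Lemma path_variation_ge0 (R : realType) (gamma : R -> Rgraph R) (a : R) (s : seq R) :
  (0 <= path_variation a gamma s)%E.
Proof. by apply: sume_ge0 => i _; exact: d_I_ge0. Qed.

(** Induction from the far end of the path: each step adds twice its length to
the width. Starting from the width [2e] keeps every step within the reach of
[decomposes_wider_d_I]. *)
Lemma decomposes_wider_chain (R : realType) (gamma : R -> Rgraph R) (e v a : R)
    (s : seq R) :
  d_I_chain gamma e a s -> (path_variation a gamma s <= v%:E)%E ->
  decomposes_wider (gamma (last a s)) (e *+ 2) ->
  decomposes_wider (gamma a) ((e + v) *+ 2).
Proof.
elim: s a v => [|x s IH] a v /=.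
  move=> _; have := path_variation_ge0 gamma a [::].
  move=> /le_trans /[apply]; rewrite lee_fin => v0 h p q pq; apply: h; lra.
move=> /andP[ax xs]; rewrite path_variation_cons => xv D.
have d0 := d_I_ge0 (gamma a) (gamma x).
have dfin : d_I (gamma a) (gamma x) \is a fin_num.
  by rewrite ge0_fin_numE //; apply: lt_trans ax _; exact: ltry.
set d := fine (d_I (gamma a) (gamma x)).
have dE : d_I (gamma a) (gamma x) = d%:E by rewrite fineK.
move: ax xv; rewrite dE lte_fin => de xv.
have vd : (path_variation x gamma s <= (v - d)%:E)%E.
  by rewrite EFinB leeBrDl.
have vd0 : 0 <= v - d.
  by rewrite -lee_fin; apply: le_trans vd; exact: path_variation_ge0.
rewrite (_ : (e + v) *+ 2 = (e + (v - d)) *+ 2 + d *+ 2); last by lra.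
by apply: (@decomposes_wider_d_I _ _ (gamma x)); [rewrite dE|lra|exact: IH xs vd D].
Qed.

(** The supremum of the points that can be reached by such a subdivision is
reached itself, by continuity at the supremum and symmetry of the distance, and
it is [b], by continuity again. *)
Lemma fine_chain (R : realType) (gamma : R -> Rgraph R) (a b e : R) :
  a <= b -> path_continuous a b gamma -> 0 < e ->
  exists2 s, itv_partition a b s & d_I_chain gamma e a s.
Proof.
move=> ab cg e0.
pose S := [set t | a <= t <= b /\
  exists2 s, itv_partition a t s & d_I_chain gamma e a s].
have Sext t t' : S t -> t < t' -> t' <= b ->
    (d_I (gamma t) (gamma t') < e%:E)%E -> S t'.
  move=> [/andP[at_ tb] [s [ps /eqP ls] cs]] tt' t'b dtt'; split.
    by rewrite t'b andbT; exact: le_trans (ltW tt').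
  exists (rcons s t').
    by split; rewrite ?last_rcons // rcons_path ps ls.
  by rewrite d_I_chain_rcons cs ls.
have Sa : S a.
  by split; [rewrite lexx|exists [::]].
have ubS : ubound S b by move=> t [/andP[]].
have supS : has_sup S by split; [exists a|exists b].
set m := sup S.
have am : a <= m by apply: sup_upper_bound.
have mb : m <= b by apply: ge_sup => //; exists a.
have mab : m \in `[a, b] by rewrite in_itv /= am.
have [eta eta0 he] := cg m mab e e0.
have Sm : S m.
  have [t St tm] := sup_adherent eta0 supS.
  have tlem : t <= m by exact: sup_upper_bound.
  have [/andP[at_ tb] _] := St.
  have [<-//|tnm] := eqVneq t m.
  apply: (Sext _ _ St _ mb); first by rewrite lt_neqAle tnm.
  rewrite d_I_sym; apply: he; first by rewrite in_itv /= at_.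
  by rewrite ler0_norm; rewrite -/m in tm; lra.
have [mb'|bm] := ltP m b; last first.
  have mE : m = b by apply/eqP; rewrite eq_le mb bm.
  by move: Sm; rewrite mE => -[].
pose t := Num.min b (m + eta / 2).
have mt : m < t by rewrite lt_min mb' /=; lra.
have tb : t <= b by rewrite ge_min lexx.
suff /(sup_upper_bound supS) : S t by rewrite leNgt mt.
apply: (Sext _ _ Sm mt tb); apply: he; first by rewrite in_itv /= tb (le_trans am (ltW mt)).
have : t <= m + eta / 2 by rewrite ge_min lexx orbT.
by rewrite gtr0_norm; lra.
Qed.

(** If the length were at most [v < h / 2], a subdivision with steps shorter
than [e = (h / 2 - v) / 2] would make all slices of [gamma a] wider than
[(e + v) *+ 2] decompose, and this width is less than [h]. *)
Lemma path_length_ge (R : realType) (gamma : R -> Rgraph R) (a b h : R) :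
  a <= b -> path_continuous a b gamma ->
  decomposes_wider (gamma b) 0 -> ~ decomposes (gamma a) 0 h ->
  ((h / 2)%:E <= path_length a b gamma)%E.
Proof.
move=> ab cg Db Da; rewrite leNgt; apply/negP => Lh; apply: Da.
have [v vh Lv] : exists2 v : R, v < h / 2 & (path_length a b gamma <= v%:E)%E.
  case: (path_length a b gamma) Lh => [r|//|_]; first by rewrite lte_fin; exists r.
  by exists (h / 2 - 1); [lra|rewrite leNye].
pose e := (h / 2 - v) / 2.
have e0 : 0 < e by rewrite /e; lra.
have [s sab cs] := fine_chain ab cg e0.
apply: (decomposes_wider_chain (v := v) cs).
- by apply: le_trans Lv; apply: ereal_sup_ubound; exists s.
- have [_ /eqP ->] := sab; move=> p q pq; apply: Db; lra.
- rewrite /e; lra.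
Qed.

(** * Graphs with two vertices *)

(** Bottom vertex at height 0, top vertex at height 4. *)
Definition pencil_level (R : realType) (i : 'I_2) : R := 4 * i%:R.

Lemma pencil_level_lt (R : realType) (i j : 'I_2) :
  (i < j)%N -> pencil_level R i < pencil_level R j.
Proof. by rewrite /pencil_level => ij; rewrite ltr_pM2l // ltr_nat. Qed.

(** The edges are indexed by [K]: the segment is the case [K = unit] and the
circle the case [K = bool]. *)
Definition pencil_data (R : realType) (K : finType) : graph_data R :=
  @GraphData R 1 (@pencil_level R) (@pencil_level_lt R)
    (fun _ => unit) (fun _ => K) (fun _ _ => tt) (fun _ _ => tt).

Definition rmor_id (R : realType) (X : rspace R) : rmor X X :=
  @RMor R X X id (fun x => cvg_id) (fun x => erefl).

Lemma riso_refl (R : realType) (X : rspace R) : riso X X.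
Proof. by exists (rmor_id X), (rmor_id X). Qed.

Definition pencil (R : realType) (K : finType) : Rgraph R :=
  RGraph (ex_intro _ (pencil_data R K) (riso_refl (gd_rspace (pencil_data R K)))).

Definition gd_pi (R : realType) (D : graph_data R) (p : gd_total D) : gd_rspace D :=
  \pi_({eq_quot (gd_equiv D)})%qT p.

Lemma gd_height_pi (R : realType) (D : graph_data R) (p : gd_total D) :
  height (gd_rspace D) (gd_pi p) = gd_proj p.
Proof.
by apply: gd_rel_proj; apply/eqmodP; rewrite reprK.
Qed.

(** Clamping to [[0, 4]] makes the parametrization of an edge a continuous map
on the whole real line. *)
Definition edge_param (R : realType) (r : R) : R := Num.max 0 (Num.min r 4).

Lemma edge_param_continuous (R : realType) : continuous (@edge_param R).
Proof.
move=> r; apply: (@continuous_max _ _ (cst 0 : R -> R) (idfun \min cst 4 : R -> R)).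
  exact: cst_continuous.
by apply: continuous_min; [exact: cvg_id|exact: cst_continuous].
Qed.

Lemma gd_itv_edge (R : realType) (K : finType) (k : K) (r : R) :
  gd_itv (@gd_edge R (pencil_data R K) ord0 k) r <-> 0 <= r <= 4.
Proof.
by rewrite /= in_itv /= /gd_lo /gd_hi /= /pencil_level mulr0 mulr1.
Qed.

Lemma edge_param_itv (R : realType) (K : finType) (k : K) (r : R) :
  edge_param r \in gd_itv (@gd_edge R (pencil_data R K) ord0 k).
Proof.
apply/mem_set/gd_itv_edge; rewrite /edge_param.
by rewrite le_max lexx /= ge_max ge_min lexx orbT andbT.
Qed.

Lemma edge_param_id (R : realType) (r : R) : 0 <= r <= 4 -> edge_param r = r.
Proof. by move=> /andP[r0 r4]; rewrite /edge_param (min_idPl r4) (max_idPr r0). Qed.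

Definition pencil_edge_total (R : realType) (K : finType) (k : K) (r : R) :
    gd_total (pencil_data R K) :=
  existT (fun k => gd_itv k) (@gd_edge R (pencil_data R K) ord0 k)
    (SigSub (edge_param_itv k r)).

Definition pencil_edge (R : realType) (K : finType) (k : K) (r : R) : pencil R K :=
  gd_pi (pencil_edge_total k r).

Lemma pencil_edge_continuous (R : realType) (K : finType) (k : K) :
  continuous (@pencil_edge R K k).
Proof.
move=> r; apply: (continuous_comp (g := @gd_pi R (pencil_data R K))).
  apply: (continuous_comp (g := existT (fun k => gd_itv k : topologicalType) _)).
    apply: (@continuous_comp_initial _ _ _ _ (fun r => SigSub (edge_param_itv k r))).
    exact: edge_param_continuous.
  exact: existT_continuous.
exact: pi_continuous.
Qed.

Lemma height_pencil_edge (R : realType) (K : finType) (k : K) (r : R) :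
  0 <= r <= 4 -> height (pencil R K) (pencil_edge k r) = r.
Proof. by move=> r04; rewrite [LHS]gd_height_pi /gd_proj /= edge_param_id. Qed.


Lemma gd_pi_glue (R : realType) (D : graph_data R) (p q : gd_total D) :
  gd_glue p q -> gd_pi p = gd_pi q.
Proof. by move=> pq; apply/eqmodP/gd_relP/rst_step. Qed.

Lemma pencil_edge0 (R : realType) (K : finType) (k : K)
    (p : gd_total (pencil_data R K)) :
  tag p = gd_vertex (@gd_l R (pencil_data R K) ord0 k) -> pencil_edge k 0 = gd_pi p.
Proof.
move=> tp; apply/gd_pi_glue/(@GlueLeft R (pencil_data R K) _ _ ord0 k) => //.
by rewrite /gd_proj /= edge_param_id ?lexx ?ler0n // /gd_lo /= /pencil_level mulr0.
Qed.

Lemma pencil_edge4 (R : realType) (K : finType) (k : K)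
    (p : gd_total (pencil_data R K)) :
  tag p = gd_vertex (@gd_r R (pencil_data R K) ord0 k) -> pencil_edge k 4 = gd_pi p.
Proof.
move=> tp; apply/gd_pi_glue/(@GlueRight R (pencil_data R K) _ _ ord0 k) => //.
by rewrite /gd_proj /= edge_param_id ?lexx ?ler0n // /gd_hi /= /pencil_level mulr1.
Qed.

Lemma pencil_edge_bottom (R : realType) (K : finType) (k k' : K) :
  pencil_edge k (0 : R) = pencil_edge k' 0.
Proof.
have vP : (0 : R) \in gd_itv (gd_vertex (@gd_l R (pencil_data R K) ord0 k)).
  by apply/mem_set; rewrite /= in_itv /= /pencil_level mulr0 lexx.
pose v : gd_total (pencil_data R K) := existT (fun k => gd_itv k) _ (SigSub vP).
by rewrite !(@pencil_edge0 _ _ _ v).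
Qed.

Lemma pencil_edge_top (R : realType) (K : finType) (k k' : K) :
  pencil_edge k (4 : R) = pencil_edge k' 4.
Proof.
have vP : (4 : R) \in gd_itv (gd_vertex (@gd_r R (pencil_data R K) ord0 k)).
  by apply/mem_set; rewrite /= in_itv /= /pencil_level mulr1 lexx.
pose v : gd_total (pencil_data R K) := existT (fun k => gd_itv k) _ (SigSub vP).
by rewrite !(@pencil_edge4 _ _ _ v).
Qed.

Lemma pencil_edge_surj (R : realType) (K : finType) (k0 : K) (x : pencil R K) :
  exists k (r : R), 0 <= r <= 4 /\ x = pencil_edge k r.
Proof.
rewrite -[x](@reprK _ {eq_quot (gd_equiv (pencil_data R K))}%qT).
move: (repr _) => p; rewrite -/(gd_pi p).
case: p => -[[i u]|[i k]] t.
- have [i0|i1] : i = widen_ord (leqnSn 1) ord0 \/ i = lift ord0 ord0.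
  + by clear u t; case: i => -[|[|//]] ilt; [left|right]; apply/val_inj.
  + exists k0, 0; rewrite lexx ler0n; split => //; symmetry; apply: pencil_edge0.
    by move: u t; rewrite i0 => -[].
  + exists k0, 4; rewrite lexx ler0n; split => //; symmetry; apply: pencil_edge4.
    by move: u t; rewrite i1 => -[].
- move: k t; rewrite (ord1 i) => k t; exists k, (\val t).
  have t04 : 0 <= \val t <= 4.
    by apply/(@gd_itv_edge R K k); exact: set_mem (valP t).
  split => //; congr gd_pi; congr existT; apply/val_inj => /=.
  by rewrite edge_param_id.
Qed.

Lemma height_pencil (R : realType) (K : finType) (k0 : K) (x : pencil R K) :
  0 <= height (pencil R K) x <= 4.
Proof.
by have [k [r [r04 ->]]] := pencil_edge_surj k0 x; rewrite height_pencil_edge.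
Qed.

(** * The interleaving of two pencils *)

Definition rmor_comp (R : realType) (X Y Z : rspace R) (g : rmor Y Z) (f : rmor X Y) :
  rmor X Z :=
  @RMor R X Z (g \o f)
    (fun x => continuous_comp (@rmor_continuous _ _ _ f x) (@rmor_continuous _ _ _ g (f x)))
    (fun x => etrans (rmor_height g (f x)) (rmor_height f x)).

Lemma zeta_continuous (R : realType) (d : R) (d0 : 0 <= d) (X : rspace R) :
  continuous (@zeta R d d0 X).
Proof.
move=> x; apply: (continuous_comp (g := @reeb_pi R (thick d X))).
  apply: (continuous_pair2 (f := idfun) (g := cst (itvsym_zero d0))) => {}x.
    exact: cvg_id.
  exact: cst_continuous.
exact: reeb_pi_continuous.
Qed.

Lemma zeta_height (R : realType) (d : R) (d0 : 0 <= d) (X : rspace R) x :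
  height (smoothing d X) (zeta d0 x) = height X x.
Proof. by rewrite [LHS]reeb_height_pi /= /thick_height /= addr0. Qed.

Definition zeta_mor (R : realType) (d : R) (d0 : 0 <= d) (X : rspace R) :
  rmor X (smoothing d X) := RMor (@zeta_continuous R d d0 X) (@zeta_height R d d0 X).

Lemma smoothing_comp_zeta (R : realType) (d : R) (d0 : 0 <= d) (X Y : rspace R)
    (s : rmor Y X) y :
  smoothing_comp (smoothing_map d (rmor_comp (zeta_mor d0 X) s) (zeta d0 y)) =
  zeta (addr_ge0 d0 d0) (s y).
Proof.
rewrite /zeta [smoothing_map _ _ _]reeb_map_pi.
apply: (etrans (smoothing_comp_pi (s y) (itvsym_zero d0) (itvsym_zero d0))).
apply: (congr1 (fun t => reeb_pi ((s y, t) : thick (d + d) X))).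
by apply/val_inj; rewrite /= addr0.
Qed.

Lemma pencil_fold_height (R : realType) (K K' : finType) (k0 : K') (k : K)
    (x : pencil R K') :
  height (pencil R K) (pencil_edge k (height (pencil R K') x)) = height (pencil R K') x.
Proof. by rewrite height_pencil_edge // height_pencil. Qed.

Lemma pencil_fold_continuous (R : realType) (K K' : finType) (k : K) :
  continuous (fun x : pencil R K' => pencil_edge k (height (pencil R K') x)).
Proof.
move=> x; apply: continuous_comp; first exact: height_continuous.
exact: pencil_edge_continuous.
Qed.

Definition pencil_fold (R : realType) (K K' : finType) (k0 : K') (k : K) :
  rmor (pencil R K') (pencil R K) :=
  RMor (@pencil_fold_continuous R K K' k) (pencil_fold_height k0 k).

(** Lift both paths to the level set of [(g h, 0)] in the thickening, by
putting the difference to [h] in the second coordinate. The lifts are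
connected and meet at the parameter [r0]. *)
Lemma zeta_meet (R : realType) (X : rspace R) (d : R) (d0 : 0 <= d)
    (g g' : R -> X) (J : set R) (h r0 : R) :
  continuous g -> continuous g' -> is_interval J -> J h -> J r0 ->
  (forall r, J r -> [/\ height X (g r) = r, height X (g' r) = r & h - d <= r <= h + d]) ->
  g r0 = g' r0 -> zeta d0 (g h) = zeta d0 (g' h).
Proof.
move=> cg cg' /connected_intervalP cJ Jh Jr0 JE gr0.
pose lift_path (f : R -> X) (r : R) : thick d X := (f r, clampS d0 (h - r)).
have lift_cont f : continuous f -> connected (lift_path f @` J).
  move=> cf; apply: connected_continuous_connected => //.
  apply: continuous_subspaceT; apply: continuous_pair2 => // r.
  apply: continuous_comp; last exact: clampS_continuous.
  by apply: continuousB; [exact: cst_continuous|exact: cvg_id].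
have lift_h f : lift_path f h = (f h, itvsym_zero d0).
  by rewrite /lift_path subrr -(clampS_id d0 (itvsym_zero d0)).
have lift_level f : (forall r, J r -> height X (f r) = r) ->
    lift_path f @` J `<=` level ((g h, itvsym_zero d0) : thick d X).
  move=> fE _ [r Jr <-]; rewrite /level /= /thick_height /= addr0 fE //.
  have [_ _ /andP[r1 r2]] := JE r Jr; have [-> _ _] := JE h Jh.
  have hr : h - r \in itvsym d by apply/mem_set; rewrite /itvsym /= in_itv /=; lra.
  by rewrite -[clamp _ _]/(\val (clampS d0 (\val (SigSub hr)))) clampS_id /= addrC subrK.
apply/reeb_pi_eq/reeb_relP.
exists (lift_path g @` J `|` lift_path g' @` J); last by right; exists h.
split.
- by left; exists h.
- by rewrite subUset; split; apply: lift_level => r /JE [].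
- apply: connectedU; [|exact: lift_cont|exact: lift_cont].
  by exists (lift_path g r0); split; exists r0; rewrite // /lift_path gr0.
Qed.

(** One of the two ends of the edges is at distance at most 2 from [h]. *)
Lemma zeta_pencil_edge (R : realType) (K : finType) (k k' : K) (d h : R) (d0 : 0 <= d) :
  2 <= d -> 0 <= h <= 4 -> zeta d0 (pencil_edge k h) = zeta d0 (pencil_edge k' h).
Proof.
move=> d2 /andP[h0 h4].
have [h2|h2] := leP h 2.
- apply: (@zeta_meet _ (pencil R K) _ _ (pencil_edge k) (pencil_edge k') `[0, h] _ 0);
    try exact: pencil_edge_continuous.
  + exact: interval_is_interval.
  + by rewrite /= in_itv /= h0 lexx.
  + by rewrite /= in_itv /= h0 lexx.
  + move=> r rJ; have /andP[r0 rh] : 0 <= r <= h by move: rJ; rewrite /= in_itv.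
    by rewrite !height_pencil_edge; [split=> //|..]; apply/andP; split; lra.
  + exact: pencil_edge_bottom.
- apply: (@zeta_meet _ (pencil R K) _ _ (pencil_edge k) (pencil_edge k') `[h, 4] _ 4);
    try exact: pencil_edge_continuous.
  + exact: interval_is_interval.
  + by rewrite /= in_itv /= h4 lexx.
  + by rewrite /= in_itv /= h4 lexx.
  + move=> r rJ; have /andP[r0 rh] : h <= r <= 4 by move: rJ; rewrite /= in_itv.
    by rewrite !height_pencil_edge; [split=> //|..]; apply/andP; split; lra.
  + exact: pencil_edge_top.
Qed.

(** Both morphisms move every point to a fixed edge at the same height; both
round trips are therefore moves between edges, which the 2-smoothing does not
see. *)
Lemma pencil_interleaved (R : realType) (K K' : finType) (k : K) (k' : K') :
  interleaved 1 (pencil R K) (pencil R K').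
Proof.
have fold_fold (L L' : finType) (l : L) (l' : L') (x : pencil R L) :
    zeta (addr_ge0 ler01 ler01) (pencil_fold R l' l (pencil_fold R l l' x)) =
    zeta (addr_ge0 ler01 ler01) x.
  rewrite (_ : pencil_fold R l' l _ = pencil_edge l (height (pencil R L) x));
    last by congr pencil_edge; exact: pencil_fold_height.
  have [j [r [r04 ->]]] := pencil_edge_surj l x.
  by rewrite height_pencil_edge //; apply: zeta_pencil_edge => //; rewrite -(natrD _ 1 1).
exists ler01.
exists (rmor_comp (zeta_mor ler01 _) (pencil_fold R k k')).
exists (rmor_comp (zeta_mor ler01 _) (pencil_fold R k' k)).
by split=> x; rewrite [X in smoothing_map _ _ X]/= smoothing_comp_zeta fold_fold.
Qed.

(** * Slices of the segment and of the circle *)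

(** The slices of a segment are connected, so the functions on them are
constant. *)
Lemma segment_decomposes (R : realType) (p q : R) :
  decomposes (pencil R unit) p q.
Proof.
move=> phi lphi; set S := slice _ _ in lphi.
exists (fun=> `[< exists2 x, S x & phi x >]), (fun=> false).
split=> [||x Sx]; [exact: locally_constant_cst..|rewrite addbF].
have cS : connected S.
  rewrite (_ : S = pencil_edge tt @` (`]p, q[ `&` `[0, 4])).
    apply: connected_continuous_connected.
      apply/connected_intervalP => r s [rpq r04] [spq s04] t rts.
      by split; apply: interval_is_interval rts.
    by apply: continuous_subspaceT; exact: pencil_edge_continuous.
  apply/seteqP; split=> [y Sy|_ [r [rpq r04] <-]].
    have [[] [r [r04 yr]]] := pencil_edge_surj tt y; exists r => //; split.
      by move: Sy; rewrite /S /slice /preimage /mkset yr height_pencil_edge.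
    by rewrite /= in_itv.
  by rewrite /S /slice /preimage /mkset height_pencil_edge //; move: r04; rewrite /= in_itv.
apply/idP/asboolP => [px|[y Sy py]]; first by exists x.
by rewrite (locally_constant_connected cS lphi Sx Sy).
Qed.

(** The interior of an edge, in the coproduct of the pieces. Excluding the ends
makes it invariant under the gluing. *)
Definition pencil_branch (R : realType) (K : finType) (k : K)
    (p : gd_total (pencil_data R K)) : bool :=
  (0 < gd_proj p < 4) && (tag p == @gd_edge R (pencil_data R K) ord0 k).

Lemma pencil_branch_rel (R : realType) (K : finType) (k : K)
    (p q : gd_total (pencil_data R K)) :
  gd_rel p q -> pencil_branch k p = pencil_branch k q.
Proof.
move=> /gd_relP; elim=> {p q} [p q|//|p q _ ->//|p q r _ -> _ ->//].
rewrite /pencil_branch.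
case=> i e _ pi ->; rewrite andbF pi (ord1 i) /gd_lo /gd_hi /= /pencil_level.
  by rewrite mulr0 ltxx.
by rewrite mulr1 ltxx andbF.
Qed.

Lemma gd_total_open_tag (R : realType) (D : graph_data R) (k : gd_piece D) :
  open [set p : gd_total D | tag p = k].
Proof.
apply/sigT_openP => j; have [->|jk] := eqVneq j k.
  by rewrite (_ : _ @^-1` _ = setT); [exact: openT|apply/seteqP; split].
rewrite (_ : _ @^-1` _ = set0); first exact: open0.
by apply/seteqP; split => // x /= /eqP; rewrite (negbTE jk).
Qed.

Definition pencil_indicator (R : realType) (K : finType) (k : K) (x : pencil R K) : bool :=
  pencil_branch k (repr (x : {eq_quot (gd_equiv (pencil_data R K))}%qT)).

Lemma pencil_indicator_pi (R : realType) (K : finType) (k : K)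
    (p : gd_total (pencil_data R K)) :
  pencil_indicator k (gd_pi p) = pencil_branch k p.
Proof. by apply: pencil_branch_rel; apply/eqmodP; rewrite reprK. Qed.

Lemma pencil_indicator_edge (R : realType) (K : finType) (k k' : K) (r : R) :
  0 < r < 4 -> pencil_indicator k (pencil_edge k' r) = (k' == k).
Proof.
move=> /andP[r0 r4]; rewrite pencil_indicator_pi /pencil_branch /gd_proj /=.
rewrite edge_param_id ?(ltW r0) ?(ltW r4) // r0 r4 /=.
rewrite -[LHS]/(Tagged (fun=> K) k' == Tagged (fun=> K) k :> {i : 'I_1 & K}) eq_Tagged.
by [].
Qed.

(** Over the open interval [(0, 4)] the graph is a disjoint union of open
edges. *)
Lemma pencil_indicator_locally_constant (R : realType) (K : finType) (k : K) :
  locally_constant (slice (pencil R K) `]0, 4[) (@pencil_indicator R K k).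
Proof.
move=> x Sx; set b := pencil_indicator k x.
pose A := [set y | slice (pencil R K) `]0, 4[ y /\ pencil_indicator k y = b].
have oA : open A.
  suff : open (@gd_pi R (pencil_data R K) @^-1` A) by [].
  rewrite openE => p [].
  rewrite /slice /preimage /mkset gd_height_pi pencil_indicator_pi => p04 pb.
  have n1 : \forall q \near p, `]0, 4[%classic (gd_proj q).
    apply: (@gd_proj_continuous _ _ p _); apply: open_nbhs_nbhs.
    by split => //; exact: interval_open.
  have n2 : \forall q \near p, tag q = tag p.
    by apply: open_nbhs_nbhs; split => //; exact: gd_total_open_tag.
  apply: filterS2 n1 n2 => q q04 qp.
  split; rewrite /slice /preimage /mkset ?gd_height_pi ?pencil_indicator_pi //.
  rewrite -pb /pencil_branch qp; congr (_ && _).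
  by move: q04 p04; rewrite /= !in_itv /= => -> ->.
by apply: filterS (open_nbhs_nbhs (conj oA (conj Sx erefl))) => y [].
Qed.

(** Take the indicator of one of the edges. The part above height 0 and the
part below height 4 are connected, so a sum of two locally constant functions
on them cannot distinguish the edges. *)
Lemma circle_not_decomposes (R : realType) : ~ decomposes (pencil R bool) 0 4.
Proof.
move=> /(_ _ (pencil_indicator_locally_constant true)) [u [v [lu lv uv]]].
have const w (J : set R) r0 : is_interval J -> J 2 -> J r0 ->
    pencil_edge true r0 = pencil_edge false r0 ->
    (forall r, J r -> 0 <= r <= 4) ->
    locally_constant (slice (pencil R bool) J) w ->
    w (pencil_edge true 2) = w (pencil_edge false 2).
  move=> /connected_intervalP cJ J2 Jr0 r0E J04 lw.
  have path k : w (pencil_edge k 2) = w (pencil_edge k r0).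
    apply: (@locally_constant_connected _ J (w \o pencil_edge k) 2 r0) => //.
    apply: locally_constant_comp lw; first exact: pencil_edge_continuous.
    by move=> r Jr; rewrite /slice /preimage /mkset height_pencil_edge // J04.
  by rewrite !path r0E.
have eu : u (pencil_edge true 2) = u (pencil_edge false 2).
  apply: (const u `]0, 4]%classic 4).
  - exact: interval_is_interval.
  - by rewrite /= in_itv /=; apply/andP; split; lra.
  - by rewrite /= in_itv /=; apply/andP; split; lra.
  - exact: pencil_edge_top.
  - by move=> r; rewrite /= in_itv /= => /andP[/ltW -> ->].
  - apply: locally_constantS lu => x; rewrite /slice /preimage /mkset.
    by rewrite /= !in_itv /= => /andP[->].
have ev : v (pencil_edge true 2) = v (pencil_edge false 2).
  apply: (const v `[0, 4[%classic 0).
  - exact: interval_is_interval.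
  - by rewrite /= in_itv /=; apply/andP; split; lra.
  - by rewrite /= in_itv /=; apply/andP; split; lra.
  - exact: pencil_edge_bottom.
  - by move=> r; rewrite /= in_itv /= => /andP[-> /ltW ->].
  - apply: locally_constantS lv => x; rewrite /slice /preimage /mkset.
    by rewrite /= !in_itv /= => /andP[_ ->].
have two04 : 0 < (2 : R) < 4 by apply/andP; split; lra.
have uvk k : pencil_indicator true (pencil_edge k (2 : R)) =
    u (pencil_edge k 2) (+) v (pencil_edge k 2).
  apply: uv; rewrite /slice /preimage /mkset height_pencil_edge.
    by rewrite /= in_itv.
  by move: two04 => /andP[/ltW -> /ltW ->].
by have := uvk true; rewrite eu ev -uvk !pencil_indicator_edge.
Qed.

Theorem corollary5p11 (R : realType) (c : R) :
  0 <= c ->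
  (forall X Y : Rgraph R, (hat_d_I X Y <= c%:E * d_I X Y)%E) ->
  2 <= c.
Proof.
move=> c0 hc; set X := pencil R bool; set Y := pencil R unit.
have dXY : (d_I X Y <= 1%:E)%E.
  apply: ereal_inf_lbound; exists 1 => //.
  exact: (pencil_interleaved R true tt).
have hXY : (2%:E <= hat_d_I X Y)%E.
  apply: le_ereal_inf_tmp => _ [a [b [gamma [ab gaX gbY cg ->]]]].
  rewrite (_ : 2 = 4 / 2 :> R); last by lra.
  apply: path_length_ge => //.
  - by rewrite gbY => p q _; exact: segment_decomposes.
  - by rewrite gaX; exact: circle_not_decomposes.
rewrite -lee_fin; apply: le_trans hXY _; apply: le_trans (hc X Y) _.
by rewrite -[leRHS]mule1; apply: lee_wpmul2l; rewrite ?lee_fin.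
Qed.
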